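(* Let $\mathcal{M}$ be a monoid generated by a finite set $G'$, and suppose the word problem for $\mathcal{M}$ (with respect to $G'$) is decidable. Then $\mathcal{R}((\mathcal{M},G'))\subseteq\mathrm{RE}$, where $\mathrm{RE}$ is the class of recursively enumerable languages.
   Context: For a monoid $\mathcal{M}$ generated by a finite set $G'=\{g_1,\dots,g_n\}$, the monoid memory model $(\mathcal{M},G')$ is the Cayley graph: cells are the elements of $\mathcal{M}$, the initial cell is the identity, and for each $x\in\mathcal{M}$ and each $g_k$ there is an edge $x\to xg_k$ marked $g_k$. An $h$-head automaton with auxiliary memory of model $M$ has a finite state set, input alphabet with endmarkers, a finite memory alphabet $\Delta$, a transition function mapping (state, the $h$ symbols under its 2-way read-only input heads, the current memory symbol) to (new state, a move in $\{-1,0,+1\}$ per head, and a mark to follow from the current cell or ''stay''), an initial state and accepting states; it starts with heads at the leftmost input symbol and memory at the initial cell and runs deterministically for a fixed memory content $\mu\colon M\to\Delta$. It accepts $w$ iff for some $\mu$ it reaches an accepting state; $\mathcal{R}(M)$ is the class of languages so recognized. *)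

(* Defs.v *)
From HB Require Import structures.
From mathcomp Require Import all_boot.
From mathcomp Require Import finmap.

Set Implicit Arguments.
Unset Strict Implicit.
Unset Printing Implicit Defensive.

(* Kleene's partial recursive functions of arity n. *)
Inductive recf : nat -> Type :=
| RZero n : recf n
| RSucc : recf 1
| RProj n (i : 'I_n) : recf n
| RComp k n (f : recf k) (g : 'I_k -> recf n) : recf n
| RPrim n (f : recf n) (g : recf n.+2) : recf n.+1
| RMin n (f : recf n.+1) : recf n.

(* [reval f v y]: f is defined at v with value y.
   RPrim recurses on the first argument: s is the sequence of its values, and
   g receives (counter, previous value, parameters).
   RMin searches for the least zero in the first argument, f being required to
   be defined at all smaller values. *)
Fixpoint reval n (f : recf n) : n.-tuple nat -> nat -> Prop :=
  match f with
  | RZero _ => fun _ y => y = 0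
  | RSucc => fun v y => y = (thead v).+1
  | RProj _ i => fun v y => y = tnth v i
  | RComp k _ f g => fun v y =>
      exists2 u : k.-tuple nat,
        forall i, reval (g i) v (tnth u i) & reval f u y
  | RPrim n f g => fun v y =>
      exists s : nat -> nat,
        [/\ reval f [tuple of behead v] (s 0),
            forall i, i < thead v ->
              reval g [tuple of i :: s i :: behead v] (s i.+1)
          & y = s (thead v)]
  | RMin _ f => fun v y =>
      reval f [tuple of y :: v] 0 /\
      forall i, i < y -> exists z, reval f [tuple of i :: v] z.+1
  end.

(* Effective coding of words: letters are numbered by [enum_rank], and
   [CodeSeq.code] is the library's bijection between seq nat and nat. *)
Definition word_code (S : finType) (w : seq S) : nat :=
  CodeSeq.code [seq val (enum_rank a) | a <- w].

Definition language (S : finType) := seq S -> Prop.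

Definition RE (S : finType) (L : language S) : Prop :=
  exists f : recf 1,
    forall w, L w <-> exists y, reval f [tuple word_code w] y.

(* The characteristic function of the relation P on words is recursive. *)
Definition recursive_word_rel (S : finType) (P : seq S -> seq S -> Prop) : Prop :=
  exists f : recf 2, forall u v,
    (P u v -> reval f [tuple word_code u; word_code v] 1) /\
    (~ P u v -> reval f [tuple word_code u; word_code v] 0).

(* A marked graph in which each cell has exactly one outgoing edge per mark. *)
Record memory_model := MemoryModel {
  cell : Type;
  mark : finType;
  init_cell : cell;
  follow : cell -> mark -> cell
}.

Section Monoid.
Variables (M : monoidType) (G : {fset M}).

Definition word_value (w : seq G) : M := (\prod_(g <- w) val g)%g.

Definition generates : Prop := forall x : M, exists w : seq G, word_value w = x.

Definition decidable_word_problem : Prop :=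
  recursive_word_rel (fun u v : seq G => word_value u = word_value v).

Definition monoid_memory : memory_model :=
  @MemoryModel M G 1%g (fun x g => x * val g)%g.

End Monoid.

Inductive tape_symbol (S : Type) := Letter of S | LeftEnd | RightEnd.
Arguments LeftEnd {S}.
Arguments RightEnd {S}.

Inductive head_move := MoveLeft | MoveStay | MoveRight.

(* The last component of a transition is the mark to follow, None for "stay". *)
Record automaton (M : memory_model) (S : finType) (h : nat) := Automaton {
  state : finType;
  msym : finType;
  trans : state -> {ffun 'I_h -> tape_symbol S} -> msym ->
          state * {ffun 'I_h -> head_move} * option (mark M);
  start : state;
  accepting : {set state}
}.

Section Run.
Variables (M : memory_model) (S : finType) (h : nat) (A : automaton M S h).
Variables (w : seq S) (mu : cell M -> msym A).

(* The endmarkers occupy positions 0 and (size w).+1, w the ones in between. *)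
Definition read (p : nat) : tape_symbol S :=
  if p is i.+1 then
    if onth w i is Some a then Letter a else RightEnd
  else LeftEnd.

(* A head that attempts to cross an endmarker stays on it. *)
Definition move_head (d : head_move) (p : nat) : nat :=
  match d with
  | MoveLeft => p.-1
  | MoveStay => p
  | MoveRight => minn p.+1 (size w).+1
  end.

Record config := Config {
  cstate : state A;
  cheads : {ffun 'I_h -> nat};
  ccell : cell M
}.

Definition init_config : config :=
  Config (start A) [ffun=> 1] (init_cell M).

Definition step (c : config) : config :=
  let: (q, d, m) :=
    trans (cstate c) [ffun i => read (cheads c i)] (mu (ccell c)) in
  Config q [ffun i => move_head (d i) (cheads c i)]
    (if m is Some g then follow (ccell c) g else ccell c).

Definition reaches_accepting : Prop :=
  exists t, cstate (iter t step init_config) \in accepting A.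

End Run.

Definition accepts (M : memory_model) (S : finType) (h : nat)
    (A : automaton M S h) (w : seq S) : Prop :=
  exists mu : cell M -> msym A, reaches_accepting w mu.

Definition recognizable (M : memory_model) (S : finType) (L : language S) : Prop :=
  exists h (A : automaton M S h),
    0 < h /\ forall w, L w <-> accepts A w.

(* Main.v *)
From HB Require Import structures.
Require Import Defs.
From mathcomp Require Import all_boot.
From mathcomp Require Import finmap.

(* A word is accepted iff there is a finite list of memory symbols which, read one per
   step in place of the memory, drives the automaton into an accepting state and is
   consistent: the same symbol is read at any two times at which the words of marks
   followed so far have the same value in the monoid. A consistent list defines a memory
   content on the visited cells, the rest being irrelevant. With an oracle for the word
   problem, consistency is decidable, so unbounded search over all lists semidecides
   acceptance. *)

Set Implicit Arguments.
Unset Strict Implicit.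
Unset Printing Implicit Defensive.

(** * Partial recursive functions: determinism and closure properties *)

(** Lets the zero found by [RMin] be compared with the value that a computability hypothesis gives
    at the same argument. *)
Lemma reval_functional n (f : recf n) v y z : reval f v y -> reval f v z -> y = z.
Proof.
elim: f v y z => {n} [n||n i|k n f IHf g IHg|n f IHf g IHg|n f IHf] v y z /=.
- by move=> -> ->.
- by move=> -> ->.
- by move=> -> ->.
- case=> u gu fu [u' gu' fu'].
  have E : u = u' by apply: eq_from_tnth => i; apply: IHg (gu i) (gu' i).
  by apply: IHf fu _; rewrite E.
- case=> s [s0 sS ->] [s' [s0' sS' ->]].
  (* The two value sequences are constrained only up to the recursion bound, so they are compared
     only there. *)
  suff H i : i <= thead v -> s i = s' i by exact: H.
  elim: i => [_|i IH lti]; first exact: IHf s0 s0'.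
  by apply: IHg (sS _ lti) _; rewrite IH 1?ltnW //; apply: sS'.
(* If two least zeros differed, the smaller one would lie where the larger one forces a positive
   value. *)
- case=> fy ly [fz lz]; case: (ltngtP y z) => // lt.
  + by have [x fx] := lz _ lt; have := IHf _ _ _ fy fx.
  + by have [x fx] := ly _ lt; have := IHf _ _ _ fz fx.
Qed.

(* [P] is a type of parameters of which a machine only sees the numbers [env p]:
   the values [F p] are then computed uniformly in [p]. *)
Definition computable_from (P : Type) n (env : P -> n.-tuple nat) (F : P -> nat) :=
  exists f : recf n, forall p, reval f (env p) (F p).

Section Closure.
Variables (P : Type) (n : nat) (env : P -> n.-tuple nat).
Implicit Types F : P -> nat.

Lemma computable_eq F F' :
  F =1 F' -> computable_from env F -> computable_from env F'.
Proof. by move=> E [f fP]; exists f => p; rewrite -E. Qed.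

Lemma computable_var F k :
  k < n -> (forall p, nth 0 (env p) k = F p) -> computable_from env F.
Proof.
by move=> ltk H; exists (RProj (Ordinal ltk)) => p /=; rewrite (tnth_nth 0) -H.
Qed.

Lemma computable_reindex (Q : Type) (h : Q -> P) F :
  computable_from env F -> computable_from (env \o h) (F \o h).
Proof. by case=> f fP; exists f => q /=. Qed.

Lemma computable_comp k (env' : P -> k.-tuple nat) F :
    (forall i, computable_from env (fun p => tnth (env' p) i)) ->
  computable_from env' F -> computable_from env F.
Proof.
move=> /fin_all_exists [g gP] [f fP]; exists (RComp f g) => p /=.
by exists (env' p) => // i; apply: gP.
Qed.

(** Substitution for the first argument: [N p] can be recomputed from [env p]. *)
Lemma computable_cons N F :
    computable_from (fun p => [tuple of N p :: env p]) F ->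
  computable_from env N -> computable_from env F.
Proof.
move=> cF cN; apply: computable_comp cF => i.
case: (unliftP ord0 i) => [j ->|->] //.
by exists (RProj j) => p /=; rewrite tnthS.
Qed.

(** Primitive recursion. To compute [R p (N p)], it is enough to express [R p i.+1] through the
    counter [i], the previous value [R p i] and the parameters, found in this order in the
    environment of the step. *)
Lemma computable_rec (R : P -> nat -> nat) N :
    computable_from env (R^~ 0) ->
    computable_from (fun x : P * nat => [tuple of x.2 :: R x.1 x.2 :: env x.1])
      (fun x => R x.1 x.2.+1) ->
  computable_from env N -> computable_from env (fun p => R p (N p)).
Proof.
case=> f fP [g gP]; apply: computable_cons.
exists (RPrim f g) => p /=; exists (R p).
(* These tuples agree as sequences and differ only in their length proofs. *)
have E : [tuple of behead [tuple of N p :: env p]] = env p by apply: val_inj.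
split=> // [|i _]; first by rewrite E.
set t := (X in reval g X _).
suff -> : t = [tuple of i :: R p i :: env p] by exact: (gP (p, i)).
exact: val_inj.
Qed.

End Closure.

Lemma computable_lift (P Q : Type) n (env : P -> n.-tuple nat) (h : Q -> P) a F :
    computable_from env F ->
  computable_from (fun q => [tuple of a q :: env (h q)]) (fun q => F (h q)).
Proof.
move=> /(computable_reindex h) cF; apply: computable_comp cF => i /=.
by exists (RProj (lift ord0 i)) => q /=; rewrite tnthS.
Qed.

(** Weakening to the environment of the step in [computable_rec], where the counter and the previous
    value precede the parameters. *)
Lemma computable_lift2 (P Q : Type) n (env : P -> n.-tuple nat) (h : Q -> P) a b F :
    computable_from env F ->
  computable_from (fun q => [tuple of a q :: b q :: env (h q)]) (fun q => F (h q)).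
Proof.
move=> cF.
apply: (@computable_lift _ _ _ (fun q => [tuple of b q :: env (h q)]) id a
  (fun q => F (h q))).
exact: computable_lift.
Qed.

(** * Arithmetic, Boolean operations and finite tables *)

Lemma computable_succ P n (env : P -> n.-tuple nat) F :
  computable_from env F -> computable_from env (fun p => (F p).+1).
Proof.
move=> [f fP]; exists (RComp RSucc (fun=> f)) => p /=.
by exists [tuple F p] => // i; rewrite (ord1 i).
Qed.

Lemma computable_const P n (env : P -> n.-tuple nat) c : computable_from env (fun=> c).
Proof. by elim: c => [|c IH]; [exists (RZero n) | apply: computable_succ]. Qed.

Lemma computable_add P n (env : P -> n.-tuple nat) F G :
    computable_from env F -> computable_from env G ->
  computable_from env (fun p => F p + G p).
Proof.
move=> cF cG; apply: (computable_rec (R := fun p i => F p + i)) cG.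
  by apply: computable_eq cF => p; rewrite addn0.
apply: computable_eq (fun x => esym (addnS _ _)) _.
by apply: computable_succ; apply: (computable_var (k := 1)).
Qed.

Lemma computable_pred P n (env : P -> n.-tuple nat) F :
  computable_from env F -> computable_from env (fun p => (F p).-1).
Proof.
move=> cF; apply: (computable_rec (R := fun _ i => i.-1)) cF.
  exact: computable_const.
by apply: (computable_var (k := 0)).
Qed.

Lemma computable_mul P n (env : P -> n.-tuple nat) F G :
    computable_from env F -> computable_from env G ->
  computable_from env (fun p => F p * G p).
Proof.
move=> cF cG; apply: (computable_rec (R := fun p i => F p * i)) cG.
  by apply: computable_eq (computable_const _ 0) => p; rewrite muln0.
apply: computable_eq (fun x => esym (mulnS _ _)) _; apply: computable_add.
  exact: computable_lift2 cF.
exact: (computable_var (k := 1)).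
Qed.

Lemma computable_sub P n (env : P -> n.-tuple nat) F G :
    computable_from env F -> computable_from env G ->
  computable_from env (fun p => F p - G p).
Proof.
move=> cF cG; apply: (computable_rec (R := fun p i => F p - i)) cG.
  by apply: computable_eq cF => p; rewrite subn0.
apply: computable_eq (fun x => esym (subnS _ _)) _.
by apply: computable_pred; apply: (computable_var (k := 1)).
Qed.

Lemma computable_exp2 P n (env : P -> n.-tuple nat) F :
  computable_from env F -> computable_from env (fun p => 2 ^ F p).
Proof.
move=> cF; apply: (computable_rec (R := fun _ i => 2 ^ i)) cF.
  exact: computable_const.
apply: computable_eq (fun x => esym (expnS _ _)) _; apply: computable_mul.
  exact: computable_const.
exact: (computable_var (k := 1)).
Qed.

Lemma computable_negb P n (env : P -> n.-tuple nat) (B : P -> bool) :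
    computable_from env (fun p => B p) ->
  computable_from env (fun p => ~~ B p).
Proof.
move=> cB; apply: (@computable_eq _ _ _ (fun p => 1 - B p)) => [p|].
  by case: (B p).
exact: computable_sub (computable_const _ 1) cB.
Qed.

Lemma computable_andb P n (env : P -> n.-tuple nat) (B C : P -> bool) :
    computable_from env (fun p => B p) -> computable_from env (fun p => C p) ->
  computable_from env (fun p => B p && C p).
Proof.
by move=> cB cC; apply: computable_eq (computable_mul cB cC) => p; rewrite mulnb.
Qed.

Lemma computable_eq0 P n (env : P -> n.-tuple nat) F :
  computable_from env F -> computable_from env (fun p => F p == 0).
Proof.
move=> cF; apply: (@computable_eq _ _ _ (fun p => 1 - F p)) => [p|].
  by case: (F p).
exact: computable_sub (computable_const _ 1) cF.
Qed.

Lemma computable_leq P n (env : P -> n.-tuple nat) F G :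
    computable_from env F -> computable_from env G ->
  computable_from env (fun p => F p <= G p).
Proof. by move=> cF cG; apply: computable_eq0; apply: computable_sub. Qed.

Lemma computable_eqn P n (env : P -> n.-tuple nat) F G :
    computable_from env F -> computable_from env G ->
  computable_from env (fun p => F p == G p).
Proof.
move=> cF cG; apply: (@computable_eq _ _ _ (fun p => (F p <= G p) && (G p <= F p))).
  by move=> p; rewrite -eqn_leq.
by apply: computable_andb; apply: computable_leq.
Qed.

(** The truth value acts as a 0/1 factor; evaluating both branches is harmless because both are
    total. *)
Lemma computable_if P n (env : P -> n.-tuple nat) (B : P -> bool) (F G : P -> nat) :
    computable_from env (fun p => B p) -> computable_from env F -> computable_from env G ->
  computable_from env (fun p => if B p then F p else G p).
Proof.
move=> cB cF cG.
apply: (@computable_eq _ _ _ (fun p => B p * F p + ~~ B p * G p)).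
  by move=> p; case: (B p); rewrite mul1n mul0n ?addn0.
by apply: computable_add; apply: computable_mul => //; apply: computable_negb.
Qed.

Lemma computable_implyb P n (env : P -> n.-tuple nat) (B C : P -> bool) :
    computable_from env (fun p => B p) -> computable_from env (fun p => C p) ->
  computable_from env (fun p => B p ==> C p).
Proof.
move=> cB cC; apply: (@computable_eq _ _ _ (fun p => ~~ (B p && ~~ C p))).
  by move=> p; rewrite negb_and negbK implybE.
by apply: computable_negb; apply: computable_andb => //; apply: computable_negb.
Qed.

Lemma computable_odd P n (env : P -> n.-tuple nat) F :
  computable_from env F -> computable_from env (fun p => odd (F p)).
Proof.
move=> cF; apply: (computable_rec (R := fun _ i => odd i)) cF.
  exact: computable_const.
by apply: computable_negb; apply: (computable_var (k := 1)).
Qed.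

Lemma computable_all P n (env : P -> n.-tuple nat) (B : P * nat -> bool) (F : P -> nat) :
    computable_from (fun x : P * nat => [tuple of x.2 :: env x.1]) (fun x => B x) ->
  computable_from env F ->
  computable_from env (fun p => all (fun i => B (p, i)) (iota 0 (F p))).
Proof.
move=> cB; apply: (computable_rec (R := fun p k => all (fun i => B (p, i)) (iota 0 k))).
  exact: computable_const.
apply: (@computable_eq _ _ _ (fun x => all (fun i => B (x.1, i)) (iota 0 x.2) && B x)).
  by case=> p i; rewrite -[i.+1]addn1 iotaD all_cat /= andbT.
apply: computable_andb; first by apply: (computable_var (k := 1)).
(* The step environment holds the previous value between the counter and the parameters; [B] skips
   it, so parameter [j] is found at position [j.+2]. *)
apply: computable_comp cB => i.
case: (unliftP ord0 i) => [j ->|->]; last by apply: (computable_var (k := 0)).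
apply: (computable_var (k := j.+2)) => [|x]; first exact: (ltn_ord j).
by rewrite (tnth_nth 0).
Qed.

(** A function on a finite type is a fixed nest of conditionals comparing the injective code with
    constants, whatever [f] is. This is how transitions and acceptance are computed. *)
Lemma computable_table P n (env : P -> n.-tuple nat) (T : finType)
    (e f : T -> nat) (t : P -> T) :
    injective e -> computable_from env (fun p => e (t p)) ->
  computable_from env (fun p => f (t p)).
Proof.
move=> inj_e ce.
pose lookup s x := foldr (fun t y => if x == e t then f t else y) 0 s.
have lookupP s u : u \in s -> lookup s (e u) = f u.
  elim: s => //= v s IH; rewrite inE (inj_eq inj_e).
  by case: eqVneq => [->|_ /IH].
apply: (@computable_eq _ _ _ (fun p => lookup (enum T) (e (t p)))).
  by move=> p; rewrite lookupP ?mem_enum.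
elim: (enum T) => [|u s IH] /=; first exact: computable_const.
by apply: computable_if => //; [apply: computable_eqn => // |];
   apply: computable_const.
Qed.

Lemma computable_half (P : Type) n (env : P -> n.-tuple nat) F :
  computable_from env F -> computable_from env (fun p => (F p)./2).
Proof.
move=> cF; apply: (computable_rec (R := fun _ i => i./2)) cF.
  exact: computable_const.
apply: (@computable_eq _ _ _ (fun x => odd x.2 + x.2./2)).
  by case=> p i /=; rewrite uphalf_half.
apply: computable_add; first apply: computable_odd.
  exact: (computable_var (k := 0)).
exact: (computable_var (k := 1)).
Qed.

(** * List operations on codes *)

Import CodeSeq.

(** In binary, least significant digit first, an entry [x] is written as [x] zeros followed by a
    one. Concatenation therefore shifts the second code by the total number of digits of the
    first. *)
Lemma code_cat s t : code (s ++ t) = code s + 2 ^ (\sum_(x <- s) x.+1) * code t.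
Proof.
elim: s => [|x s IH]; first by rewrite big_nil mul1n.
rewrite big_cons /= IH doubleD -addSn mulnDr addSn expnS expnD -!mul2n.
by congr (_ + _); rewrite !mulnA; congr (_ * _ * _); rewrite mulnC.
Qed.

(** Appending a mark to a word thus only adds a power of two to its code. *)
Lemma code_rcons s x : code (rcons s x) = code s + 2 ^ (\sum_(y <- s) y.+1 + x).
Proof. by rewrite -cats1 code_cat /= muln1 expnD. Qed.

Lemma code_eq0 s : (code s == 0) = (s == [::]).
Proof. by case: s => //= x s; rewrite muln_eq0 expn_eq0. Qed.

(** This bound and [head_code] show that [code s] iterations suffice for the recursions that extract
    sizes, heads and tails. *)
Lemma size_code s : size s <= code s.
Proof.
elim: s => //= x s IH; rewrite -(mul1n (size s).+1) leq_mul ?expn_gt0 //.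
by rewrite ltnS (leq_trans IH) // -addnn leq_addr.
Qed.

Lemma head_code s : head 0 s <= code s.
Proof.
case: s => //= x s; rewrite -[x in x <= _]muln1 leq_mul //.
exact: ltnW (ltn_expl _ _).
Qed.

(* Obtained from [code s = 2 ^ x * (2 * code s' + 1)] for [s = x :: s'] by halving
   [i] times, or until the number is odd. *)
Definition halve_code s i :=
  2 ^ (head 0 s - i) * ((s != [::]) + (code (behead s)).*2).

(** Oddness signals that the leading zeros are gone; the empty list has code 0, which never becomes
    odd. *)
Lemma odd_halve_code s i : odd (halve_code s i) = (s != [::]) && (head 0 s <= i).
Proof.
rewrite /halve_code oddM oddX oddD odd_double addbF orbF subn_eq0 andbC.
by case: (s == _).
Qed.

Lemma halve_codeS s i : halve_code s i.+1 =
  if odd (halve_code s i) then halve_code s i else (halve_code s i)./2.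
Proof.
rewrite odd_halve_code; case: eqVneq => [->|/= nil_s].
  by rewrite /halve_code !muln0.
case: leqP => [le|lt]; first by rewrite /halve_code (eqP le) (eqP (leqW le)).
by rewrite /halve_code -(subnSK lt) expnS -mulnA mul2n doubleK.
Qed.

Lemma computable_halve_code :
  computable_from (fun x : seq nat * nat => [tuple code x.1; x.2])
    (fun x => halve_code x.1 x.2).
Proof.
apply: (computable_rec (R := fun x i => halve_code x.1 i)).
- apply: (computable_var (k := 0)) => // -[s i] /=.
  by case: s => //= x s; rewrite /halve_code subn0.
- apply: (computable_eq (fun x => esym (halve_codeS _ _))).
  have ? : computable_from
      (fun x : seq nat * nat * nat =>
         [tuple of x.2 :: halve_code x.1.1 x.2 :: [tuple code x.1.1; x.1.2]])
      (fun x => halve_code x.1.1 x.2) by apply: (computable_var (k := 1)).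
  by apply: computable_if; [apply: computable_odd | | apply: computable_half].
- exact: (computable_var (k := 1)).
Qed.

Lemma computable_comp2 P n (env : P -> n.-tuple nat) (Q : Type)
    (e e' : Q -> nat) F (q : P -> Q) :
    computable_from (fun x => [tuple e x; e' x]) F ->
    computable_from env (fun p => e (q p)) ->
  computable_from env (fun p => e' (q p)) -> computable_from env (fun p => F (q p)).
Proof.
move=> /(computable_reindex q) cF ce ce'; apply: computable_comp cF => i /=.
by case: (unliftP ord0 i) => [j ->|->] //; rewrite (ord1 j).
Qed.

Lemma computable_behead_code P n (env : P -> n.-tuple nat) s :
    computable_from env (fun p => code (s p)) ->
  computable_from env (fun p => code (behead (s p))).
Proof.
move=> cs.
(* By [head_code], [code s] halvings remove all leading zeros; one more drops the one that ends the
   first entry. *)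
apply: (@computable_eq _ _ _ (fun p => (halve_code (s p) (code (s p)))./2)).
  move=> p; rewrite /halve_code (eqP (head_code _)) mul1n.
  by rewrite half_bit_double.
apply: computable_half.
exact: (computable_comp2 (q := fun p => (s p, code (s p))) computable_halve_code).
Qed.

(** The head is the number of leading zeros. The recursion counts them: [minn i (head 0 s)] grows by
    one exactly when the list is nonempty and its code is still even after [i] halvings. *)
Lemma computable_head_code P n (env : P -> n.-tuple nat) s :
    computable_from env (fun p => code (s p)) ->
  computable_from env (fun p => head 0 (s p)).
Proof.
move=> cs.
apply: (@computable_eq _ _ _ (fun p => minn (code (s p)) (head 0 (s p)))).
  by move=> p; apply/minn_idPr/head_code.
apply: (computable_rec (R := fun p i => minn i (head 0 (s p)))) (cs).
  by apply: computable_eq (computable_const _ 0) => p; rewrite min0n.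
apply: (@computable_eq _ _ _ (fun x => minn x.2 (head 0 (s x.1)) +
  ((code (s x.1) != 0) && ~~ odd (halve_code (s x.1) x.2)))).
  case=> p i /=; rewrite odd_halve_code code_eq0.
  case: (s p) => [|x t] /=; first by rewrite !minn0.
  case: leqP => h /=.
    by rewrite addn0 (minn_idPr (leqW h)).
  by rewrite addn1 (minn_idPl h).
apply: computable_add; first exact: (computable_var (k := 1)).
have cs2 := computable_lift2 fst snd (fun x => minn x.2 (head 0 (s x.1))) cs.
apply: computable_andb; apply: computable_negb.
  exact: computable_eq0.
apply: computable_odd.
apply: (computable_comp2 (q := fun x => (s x.1, x.2)) computable_halve_code) => //.
exact: (computable_var (k := 0)).
Qed.

Lemma computable_code_drop P n (env : P -> n.-tuple nat) s i :
    computable_from env (fun p => code (s p)) -> computable_from env i ->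
  computable_from env (fun p => code (drop (i p) (s p))).
Proof.
move=> cs ci; apply: (computable_rec (R := fun p j => code (drop j (s p)))) ci.
  by apply: computable_eq cs => p; rewrite drop0.
apply: (@computable_eq _ _ _ (fun x => code (behead (drop x.2 (s x.1))))).
  by case=> p j; rewrite -drop1 drop_drop.
by apply: computable_behead_code; apply: (computable_var (k := 1)).
Qed.

Lemma computable_nth_code P n (env : P -> n.-tuple nat) s i :
    computable_from env (fun p => code (s p)) -> computable_from env i ->
  computable_from env (fun p => nth 0 (s p) (i p)).
Proof.
move=> cs ci; apply: (@computable_eq _ _ _ (fun p => head 0 (drop (i p) (s p)))).
  by move=> p; rewrite -nth0 nth_drop addn0.
by apply: computable_head_code; apply: computable_code_drop.
Qed.

(** Same counting as for the head: [i] contributes one exactly when dropping [i] entries leaves a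
    nonempty list. *)
Lemma computable_size_code P n (env : P -> n.-tuple nat) (s : P -> seq nat) :
    computable_from env (fun p => code (s p)) ->
  computable_from env (fun p => size (s p)).
Proof.
move=> cs; apply: (@computable_eq _ _ _ (fun p => minn (code (s p)) (size (s p)))).
  by move=> p; apply/minn_idPr/size_code.
apply: (computable_rec (R := fun p i => minn i (size (s p)))) (cs).
  by apply: computable_eq (computable_const _ 0) => p; rewrite min0n.
apply: (@computable_eq _ _ _ (fun x => minn x.2 (size (s x.1)) +
  (code (drop x.2 (s x.1)) != 0))).
  case=> p i /=; rewrite code_eq0 -size_eq0 size_drop subn_eq0.
  case: leqP => h /=.
    by rewrite addn0 (minn_idPr (leqW h)).
  by rewrite addn1 (minn_idPl h).
apply: computable_add; first exact: (computable_var (k := 1)).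
apply: computable_negb; apply: computable_eq0; apply: computable_code_drop.
  exact: (computable_lift2 fst snd _ cs).
exact: (computable_var (k := 0)).
Qed.

Lemma computable_code_cons P n (env : P -> n.-tuple nat) F s :
    computable_from env F -> computable_from env (fun p => code (s p)) ->
  computable_from env (fun p => code (F p :: s p)).
Proof.
move=> cF cs.
apply: (@computable_eq _ _ _ (fun p => 2 ^ F p * (code (s p) + code (s p)).+1)).
  by move=> p; rewrite addnn.
apply: computable_mul; first exact: computable_exp2.
by apply: computable_succ; apply: computable_add.
Qed.

(** The list [r] is fixed, so the program is assembled by induction on it. *)
Lemma computable_code_map P n (env : P -> n.-tuple nat) (I : Type)
    (F : P -> I -> nat) (r : seq I) :
    (forall i, computable_from env (F^~ i)) ->
  computable_from env (fun p => code (map (F p) r)).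
Proof.
move=> cF; elim: r => [|i r IH]; first exact: computable_const.
exact: computable_code_cons.
Qed.

(** * Unbounded search and the word problem oracle *)

(** Since [code] is a bijection, every number is a candidate certificate and [RMin] can try them in
    order. The certificate comes first in the environment because [RMin] searches over the first
    argument. *)
Lemma RE_certificate (S : finType) (C : seq S -> seq nat -> bool) :
    computable_from (fun x : seq S * seq nat => [tuple code x.2; word_code x.1])
      (fun x => C x.1 x.2) ->
  RE (fun w => exists s, C w s).
Proof.
(* [RMin] looks for a zero, hence the negated test. *)
move=> /computable_negb [f fP]; exists (RMin f) => w; split=> [[s Cs]|[y [fy _]]].
  pose Q y := C w (decode y).
  have exQ : exists y, Q y by exists (code s); rewrite /Q codeK.
  have f_at y : reval f [tuple y; word_code w] (~~ Q y).
    by have := fP (w, decode y); rewrite /= decodeK.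
  case: (ex_minnP exQ) => y Qy min_y; exists y => /=.
  have E i : [tuple of i :: [tuple word_code w]] = [tuple i; word_code w].
    exact: val_inj.
  rewrite E; split=> [|i lti]; first by have := f_at y; rewrite Qy.
  exists 0; rewrite E; have := f_at i.
  by case: (boolP (Q i)) => // /min_y; rewrite leqNgt lti.
exists (decode y); have /= := fP (w, decode y); rewrite decodeK => fy'.
have E : [tuple of y :: [tuple word_code w]] = [tuple y; word_code w].
  exact: val_inj.
rewrite E in fy; have := reval_functional fy fy'.
by case: (C _ _).
Qed.

(** Boolean equality in the monoid decides which of the two clauses specifying the oracle
    applies. *)
Lemma computable_word_problem (M : monoidType) (G : {fset M}) P n
    (env : P -> n.-tuple nat) (u v : P -> seq G) :
    decidable_word_problem G ->
    computable_from env (fun p => word_code (u p)) ->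
    computable_from env (fun p => word_code (v p)) ->
  computable_from env (fun p => word_value (u p) == word_value (v p)).
Proof.
case=> f fP; have cf : computable_from
    (fun x : seq G * seq G => [tuple word_code x.1; word_code x.2])
    (fun x => word_value x.1 == word_value x.2).
  exists f => -[x y] /=; have [f1 f0] := fP x y.
  by case: (word_value x =P word_value y) => [/f1|/f0].
exact: (computable_comp2 (q := fun p => (u p, v p)) cf).
Qed.

(** * Tape symbols and head movements *)

Section TapeSymbol.
Variable S : finType.

(** This encoding makes tape symbols a finite type, so that the transition function becomes a finite
    table. *)
Definition tape_symbol_to_option (x : tape_symbol S) : option (option S) :=
  match x with Letter a => Some (Some a) | LeftEnd => Some None | RightEnd => None end.

Definition tape_symbol_of_option (x : option (option S)) : tape_symbol S :=
  match x with Some (Some a) => Letter a | Some None => LeftEnd | None => RightEnd end.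

Lemma tape_symbol_to_optionK : cancel tape_symbol_to_option tape_symbol_of_option.
Proof. by case. Qed.

HB.instance Definition _ := Finite.copy (tape_symbol S) (can_type tape_symbol_to_optionK).

Definition tape_symbol_code (x : tape_symbol S) : nat :=
  match x with Letter a => (enum_rank a).+2 | LeftEnd => 0 | RightEnd => 1 end.

Lemma tape_symbol_code_inj : injective tape_symbol_code.
Proof. by case=> [a||] [b||] //= [] /val_inj/enum_rank_inj ->. Qed.

Lemma computable_read P n (env : P -> n.-tuple nat) (w : P -> seq S) F :
    computable_from env (fun p => word_code (w p)) -> computable_from env F ->
  computable_from env (fun p => tape_symbol_code (read (w p) (F p))).
Proof.
(* Tape position [i.+1] carries letter [i]. At a nonzero position, [r p] is thus empty exactly when
   the head is past the word, and otherwise begins with the letter read. *)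
move=> cw cF; pose r p := drop (F p).-1 [seq val (enum_rank a) | a <- w p].
have cr : computable_from env (fun p => code (r p)).
  by apply: computable_code_drop => //; apply: computable_pred.
apply: (@computable_eq _ _ _ (fun p => if F p == 0 then 0 else
    if code (r p) == 0 then 1 else (head 0 (r p)).+2)).
  move=> p; rewrite code_eq0 /r; case: (F p) => //= i.
  rewrite -nth0 nth_drop addn0 -size_eq0 size_drop size_map subn_eq0 leqNgt -onthTE.
  case E: (onth (w p) i) => [a|] //=.
  have lt : i < size (w p) by rewrite -onthTE E.
  by rewrite (nth_map a) // -odflt_onth E.
apply: computable_if; first exact: computable_eq0.
  exact: computable_const.
apply: computable_if; first exact: computable_eq0.
  exact: computable_const.
by do 2! apply: computable_succ; apply: computable_head_code.
Qed.

Definition head_move_code (d : head_move) : nat :=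
  match d with MoveLeft => 0 | MoveStay => 1 | MoveRight => 2 end.

Lemma computable_move_head P n (env : P -> n.-tuple nat) (w : P -> seq S) d F :
    computable_from env (fun p => word_code (w p)) ->
    computable_from env (fun p => head_move_code (d p)) -> computable_from env F ->
  computable_from env (fun p => move_head (w p) (d p) (F p)).
Proof.
move=> cw cd cF.
have csz : computable_from env (fun p => (size (w p)).+1).
  apply: computable_succ; apply: computable_eq (computable_size_code cw) => p.
  by rewrite size_map.
apply: (@computable_eq _ _ _ (fun p => if head_move_code (d p) == 0 then (F p).-1
    else if head_move_code (d p) == 1 then F p
    else if (F p).+1 < (size (w p)).+1 then (F p).+1 else (size (w p)).+1)).
  by move=> p; case: (d p).
apply: computable_if; [exact: computable_eq0 | exact: computable_pred |].
apply: computable_if => //; first by apply: computable_eqn => //; apply: computable_const.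
apply: computable_if => //; last exact: computable_succ.
by apply: computable_leq => //; do 2! apply: computable_succ.
Qed.

End TapeSymbol.

(** * Certificates of acceptance *)

Section Certificate.
Variables (M : monoidType) (G : {fset M}) (S : finType) (h : nat).
Variables (A : automaton (monoid_memory G) S h) (m0 : msym A).

(* A configuration whose memory cell is given by a word over the generators. *)
Definition trace_config : Type := (state A * {ffun 'I_h -> nat} * seq G)%type.

Definition trace_step (w : seq S) (m : msym A) (c : trace_config) : trace_config :=
  let: (q, d, g) := trans c.1.1 [ffun i => read w (c.1.2 i)] m in
  (q, [ffun i => move_head w (d i) (c.1.2 i)],
   if g is Some a then rcons c.2 a else c.2).

(** Numbers that are not ranks of memory symbols decode to [m0], so every list of numbers drives a
    trace. *)
Definition symbol (s : seq nat) (i : nat) : msym A :=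
  oapp (@enum_val _ (mem (msym A))) m0 (insub (nth 0 s i)).

Definition trace (w : seq S) (s : seq nat) (i : nat) : trace_config :=
  iteri i (fun j => trace_step w (symbol s j)) (start A, [ffun=> 1], [::]).

(* [s] lists the memory symbols read by an accepting run: they must not depend on the
   time at which a cell is read. *)
Definition certificate (w : seq S) (s : seq nat) : bool :=
  ((trace w s (size s)).1.1 \in accepting A) &&
  all (fun i => all (fun j =>
      (word_value (trace w s i).2 == word_value (trace w s j).2) ==>
      (symbol s i == symbol s j)) (iota 0 (size s))) (iota 0 (size s)).

Definition config_of_trace (c : trace_config) : config A :=
  Config c.1.1 c.1.2 (word_value c.2 : cell (monoid_memory G)).

Lemma step_config_of_trace w (mu : cell (monoid_memory G) -> msym A) c :
  step w mu (config_of_trace c) = config_of_trace (trace_step w (mu (word_value c.2)) c).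
Proof.
rewrite /step /trace_step /=; case: trans => [[q d] [g|]] //=.
by rewrite /config_of_trace /= /word_value -cats1 big_cat big_seq1.
Qed.

(** Agreement strictly before time [t] suffices, since each step reads the cell it starts from. *)
Lemma iter_step_trace w (mu : cell (monoid_memory G) -> msym A) s t :
    (forall i, i < t -> mu (word_value (trace w s i).2) = symbol s i) ->
  iter t (step w mu) (init_config A) = config_of_trace (trace w s t).
Proof.
elim: t => [_|t IH mu_s].
  by rewrite /= /init_config /config_of_trace /= /word_value big_nil.
rewrite iterS IH => [|i lti]; last exact/mu_s/ltnW.
by rewrite step_config_of_trace mu_s.
Qed.

Lemma accepts_certificate w : accepts A w <-> exists s, certificate w s.
Proof.
split=> [[mu [t acc]]|[s /andP [acc /allP consist]]].
  pose c i : cell (monoid_memory G) := ccell (iter i (step w mu) (init_config A)).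
  (* The certificate records the symbols read during the first [t] steps of the accepting run. *)
  pose s := mkseq (fun i => val (enum_rank (mu (c i)))) t.
  have sz_s : size s = t by rewrite size_mkseq.
  have symb i : i < t -> symbol s i = mu (c i).
    by move=> lti; rewrite /symbol nth_mkseq // valK /= enum_rankK.
  have run i : i <= t -> iter i (step w mu) (init_config A) = config_of_trace (trace w s i).
    elim: i => [_|i IH lti].
      by rewrite /= /init_config /config_of_trace /= /word_value big_nil.
    rewrite iterS IH 1?ltnW // step_config_of_trace /= symb //.
    by rewrite /c IH 1?ltnW.
  exists s; rewrite /certificate sz_s; apply/andP; split.
    by rewrite run // in acc.
  apply/allP => i; rewrite mem_iota => /= lti; apply/allP => j.
  rewrite mem_iota => /= ltj; apply/implyP => /eqP E.
  (* Equal word values denote the same cell, where the fixed content [mu] holds one symbol. *)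
  by rewrite !symb // /c !run 1?ltnW //= E.
(* A cell visited before time [size s] gets the symbol of some visit, any other cell gets [m0]. *)
pose mu (x : cell (monoid_memory G)) :=
  if [pick i : 'I_(size s) | word_value (trace w s i).2 == x] is Some i
  then symbol s i else m0.
exists mu, (size s); rewrite (iter_step_trace (s := s)) // => i lti.
(* The visit [j] that is picked may differ from [i]; consistency makes the two symbols equal. *)
rewrite /mu; case: pickP => [j|/(_ (Ordinal lti))] /=; last by rewrite eqxx.
have jin : val j \in iota 0 (size s) by rewrite mem_iota /=.
move=> E; have /allP/(_ i) := consist _ jin.
by rewrite mem_iota E => /(_ lti) /eqP.
Qed.

(** * Computability of the certificate test *)

(* The sum is the exponent of 2 needed by [code_rcons] to append a mark to the word. *)
Definition trace_code (c : trace_config) : nat :=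
  code [:: val (enum_rank c.1.1), word_code c.2, \sum_(a <- c.2) (enum_rank a).+1
         & [seq c.1.2 i | i <- enum 'I_h]].

Definition input_code
    (x : state A * {ffun 'I_h -> tape_symbol S} * msym A) : nat :=
  code [:: val (enum_rank x.1.1), val (enum_rank x.2)
         & [seq tape_symbol_code (x.1.2 i) | i <- enum 'I_h]].

(** Allows [computable_table] to look up transitions by the code of their input. *)
Lemma input_code_inj : injective input_code.
Proof.
move=> [[q r] m] [[q' r'] m'] /(can_inj codeK) /= [].
move=> /val_inj/enum_rank_inj -> /val_inj/enum_rank_inj -> /eq_in_map E.
congr (_, _, _); apply/ffunP => i; apply: tape_symbol_code_inj.
by apply: E; rewrite mem_enum.
Qed.

Section TraceComponents.
Variables (P : Type) (n : nat) (env : P -> n.-tuple nat) (c : P -> trace_config).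
Hypothesis cc : computable_from env (fun p => trace_code (c p)).

Lemma computable_trace_nth k : computable_from env (fun p =>
  nth 0 [:: val (enum_rank (c p).1.1), word_code (c p).2,
            \sum_(a <- (c p).2) (enum_rank a).+1
          & [seq (c p).1.2 i | i <- enum 'I_h]] k).
Proof. exact: computable_nth_code cc (computable_const _ k). Qed.

Lemma computable_trace_state : computable_from env (fun p => enum_rank (c p).1.1).
Proof. exact: computable_trace_nth 0. Qed.

Lemma computable_trace_word : computable_from env (fun p => word_code (c p).2).
Proof. exact: computable_trace_nth 1. Qed.

Lemma computable_trace_weight :
  computable_from env (fun p => \sum_(a <- (c p).2) (enum_rank a).+1).
Proof. exact: computable_trace_nth 2. Qed.

Lemma computable_trace_head (i : 'I_h) : computable_from env (fun p => (c p).1.2 i).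
Proof.
apply: computable_eq (computable_trace_nth i.+3) => p /=.
by rewrite (nth_map i) ?size_enum_ord // nth_ord_enum.
Qed.

End TraceComponents.

(** The new state, the head moves and the mark depend on finitely many inputs and come from tables;
    the unbounded data, namely the word, its weight and the head positions, are updated
    arithmetically. *)
Lemma computable_trace_step P n (env : P -> n.-tuple nat) w m c :
    computable_from env (fun p => word_code (w p)) ->
    computable_from env (fun p => enum_rank (m p)) ->
    computable_from env (fun p => trace_code (c p)) ->
  computable_from env (fun p => trace_code (trace_step (w p) (m p) (c p))).
Proof.
move=> cw cm cc.
pose x p := ((c p).1.1, [ffun i => read (w p) ((c p).1.2 i)], m p).
have cx : computable_from env (fun p => input_code (x p)).
  apply: computable_code_cons; first exact: computable_trace_state.
  apply: computable_code_cons => //.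
  apply: (@computable_code_map _ _ _ _ (fun p i => tape_symbol_code ((x p).1.2 i))) => i.
  have := computable_read cw (computable_trace_head cc i).
  by apply: computable_eq => p; rewrite ffunE.
have out f : computable_from env (fun p => f (x p)).
  exact: (computable_table _ input_code_inj cx).
pose tr (y : state A * {ffun 'I_h -> tape_symbol S} * msym A) := trans y.1.1 y.1.2 y.2.
(* The value 0 means stay. For a mark, its rank plus one is the increase of the weight, and the
   predecessor of this is the entry that [code_rcons] appends. *)
pose mk p : nat := oapp (fun a : G => (enum_rank a).+1) 0 (tr (x p)).2.
have cmk : computable_from env mk.
  exact: (out (fun y => oapp (fun a : G => (enum_rank a).+1) 0 (tr y).2)).
have cL := computable_trace_weight cc.
have cu := computable_trace_word cc.
have E p : trace_code (trace_step (w p) (m p) (c p)) =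
  code [:: val (enum_rank (tr (x p)).1.1),
     if mk p == 0 then word_code (c p).2
     else word_code (c p).2 + 2 ^ (\sum_(a <- (c p).2) (enum_rank a).+1 + (mk p).-1),
     \sum_(a <- (c p).2) (enum_rank a).+1 + mk p
   & [seq move_head (w p) ((tr (x p)).1.2 i) ((c p).1.2 i) | i <- enum 'I_h]].
  rewrite /trace_step /mk /tr /x /=; case: trans => [[q d] g] /=.
  rewrite /trace_code /=; congr (code [:: _, _, _ & _]).
  - case: g => [a|] //=.
    by rewrite /word_code map_rcons code_rcons big_map.
  - case: g => [a|] //=; last by rewrite addn0.
    by rewrite -cats1 big_cat big_seq1.
  - by apply: eq_map => i; rewrite ffunE.
apply: computable_eq (fun p => esym (E p)) _.
apply: computable_code_cons; first exact: (out (fun y => val (enum_rank (tr y).1.1))).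
apply: computable_code_cons.
  apply: computable_if => //; first exact: computable_eq0.
  apply: computable_add => //; apply: computable_exp2; apply: computable_add => //.
  exact: computable_pred.
apply: computable_code_cons; first exact: computable_add.
apply: computable_code_map => i; apply: computable_move_head => //.
  exact: (out (fun y => head_move_code ((tr y).1.2 i))).
exact: computable_trace_head.
Qed.

Lemma computable_symbol P n (env : P -> n.-tuple nat) s i :
    computable_from env (fun p => code (s p)) -> computable_from env i ->
  computable_from env (fun p => enum_rank (symbol (s p) (i p))).
Proof.
move=> cs ci.
apply: (@computable_eq _ _ _ (fun p => if nth 0 (s p) (i p) < #|msym A|
    then nth 0 (s p) (i p) else enum_rank m0)).
  move=> p; rewrite /symbol; case: insubP => [k -> <-|/negbTE -> //].
  by rewrite /= enum_valK.
have cn := computable_nth_code cs ci.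
apply: computable_if => //; last exact: computable_const.
by apply: computable_leq; [apply: computable_succ | apply: computable_const].
Qed.

Lemma computable_trace P n (env : P -> n.-tuple nat) w s i :
    computable_from env (fun p => word_code (w p)) ->
    computable_from env (fun p => code (s p)) -> computable_from env i ->
  computable_from env (fun p => trace_code (trace (w p) (s p) (i p))).
Proof.
move=> cw cs ci.
apply: (computable_rec (R := fun p i => trace_code (trace (w p) (s p) i))) ci.
  exact: (computable_const _ (trace_code (start A, [ffun=> 1], [::]))).
apply: computable_trace_step.
- exact: (computable_lift2 fst snd _ cw).
- apply: computable_symbol; first exact: (computable_lift2 fst snd _ cs).
  exact: (computable_var (k := 0)).
- exact: (computable_var (k := 1)).
Qed.

Lemma computable_certificate : decidable_word_problem G ->
  computable_from (fun x : seq S * seq nat => [tuple code x.2; word_code x.1])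
    (fun x => certificate x.1 x.2).
Proof.
move=> wp; set env := (X in computable_from X).
have cs : computable_from env (fun x => code x.2) by exact: (computable_var (k := 0)).
have cw : computable_from env (fun x => word_code x.1) by exact: (computable_var (k := 1)).
have csz := computable_size_code cs.
apply: computable_andb.
  apply: (computable_table (e := fun q : state A => val (enum_rank q))
    (fun q : state A => (q \in accepting A) : nat)).
    by move=> q q' /val_inj/enum_rank_inj.
  exact: computable_trace_state (computable_trace cw cs csz).
apply: (computable_all (B := fun x => all (fun j =>
      (word_value (trace x.1.1 x.1.2 x.2).2 == word_value (trace x.1.1 x.1.2 j).2) ==>
      (symbol x.1.2 x.2 == symbol x.1.2 j)) (iota 0 (size x.1.2)))) => //.
apply: (computable_all (B := fun y =>
      (word_value (trace y.1.1.1 y.1.1.2 y.1.2).2 ==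
       word_value (trace y.1.1.1 y.1.1.2 y.2).2) ==>
      (symbol y.1.1.2 y.1.2 == symbol y.1.1.2 y.2))); last first.
  exact: (computable_lift fst snd csz).
(* After two bounded quantifiers the environment lists [j], [i], the code of the certificate and
   that of the word. *)
set env2 := (X in computable_from X).
have cs2 : computable_from env2 (fun y => code y.1.1.2) by exact: (computable_var (k := 2)).
have cw2 : computable_from env2 (fun y => word_code y.1.1.1) by exact: (computable_var (k := 3)).
have ci : computable_from env2 (fun y => y.1.2) by exact: (computable_var (k := 1)).
have cj : computable_from env2 (fun y => y.2) by exact: (computable_var (k := 0)).
apply: computable_implyb.
  by apply: computable_word_problem => //; apply: computable_trace_word;
     apply: computable_trace.
apply: (@computable_eq _ _ _ (fun y =>
   val (enum_rank (symbol y.1.1.2 y.1.2)) == val (enum_rank (symbol y.1.1.2 y.2)))).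
  by move=> y; rewrite (inj_eq val_inj) (inj_eq enum_rank_inj).
by apply: computable_eqn; apply: computable_symbol.
Qed.

End Certificate.

Theorem theorem7 (M : monoidType) (G : {fset M}) :
  generates G ->
  decidable_word_problem G ->
  forall (S : finType) (L : language S),
    recognizable (monoid_memory G) L -> RE L.
Proof.
move=> _ wp S L [h [A [_ LA]]].
have RE_eq (L' : language S) : (forall w, L w <-> L' w) -> RE L' -> RE L.
  by move=> LL' [f fP]; exists f => w; rewrite LL'.
(* Decoding needs a default symbol [m0]. If there are no memory symbols, no memory content exists,
   so the language is empty. *)
case: (pickP (@predT (msym A))) => [m0 _|no_sym].
  apply: RE_eq (RE_certificate (computable_certificate m0 wp)) => w.
  by rewrite LA; apply: accepts_certificate.
apply: RE_eq (RE_certificate (C := fun _ _ => false) (computable_const _ 0)) => w.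
by rewrite LA; split=> [[mu _]|[]] //; have := no_sym (mu 1%g).
Qed.
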